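(* Suppose the influence function $h_\mu$ of $J:\mathcal{P}(\mathcal{X})\to\mathbb{R}$ exists at each $\mu\in\mathcal{P}(\mathcal{X})$. Suppose also that $J$ satisfies the following ''steepness'' restriction: for each fixed $\mu\in\mathcal{P}(\mathcal{X})$, each fixed $x\in\mathcal{X}$, and small enough $t>0$, $$\big|J((1-t)\mu+t\delta_x)-J((1-t)\mu+t\delta_y)\big|\le t\,o(\|x-y\|),\qquad y\in\mathcal{X}.$$ Then, for each $\mu\in\mathcal{P}(\mathcal{X})$, the influence function $h_\mu$ of $J$ is continuous on $\mathcal{X}$.
   Context: $\mathcal{X}$ is a nonempty compact subset of $\mathbb{R}^d$, $\mathcal{P}(\mathcal{X})$ is the set of Borel probability measures on $\mathcal{X}$, $\delta_x$ is the Dirac measure at $x$, and $\|\cdot\|$ on $\mathbb{R}^d$ is the Euclidean norm. The influence function of $J$ at $\mu$ is $h_\mu:\mathcal{X}\to\mathbb{R}$, $h_\mu(x)=\lim_{t\to0^+}\frac1t\{J(\mu+t(\delta_x-\mu))-J(\mu)\}$; it exists at $\mu$ if this limit exists and is finite for every $x\in\mathcal{X}$. The steepness restriction means: for each $\mu$ and $x$ there exist $t_0>0$ and a function $\omega:[0,\infty)\to[0,\infty)$ with $\omega(s)/s\to0$ as $s\to0^+$ such that $|J((1-t)\mu+t\delta_x)-J((1-t)\mu+t\delta_y)|\le t\,\omega(\|x-y\|)$ for all $t\in(0,t_0)$ and all $y\in\mathcal{X}$. *)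

(* Defs.v *)
From HB Require Import structures.
From mathcomp Require Import all_boot all_order all_algebra.
From mathcomp Require Import all_classical all_reals all_analysis.
Import Order.TTheory GRing.Theory Num.Theory.
Import numFieldTopology.Exports.

Set Implicit Arguments.
Unset Strict Implicit.
Unset Printing Implicit Defensive.

Local Open Scope classical_set_scope.
Local Open Scope ring_scope.

(* The library norm on 'rV[R]_d is the sup norm; both induce the topology of
   'rV[R]_d. *)
Definition euclidean_norm (R : realType) (d : nat) (v : 'rV[R]_d) : R :=
  Num.sqrt (\sum_(i < d) v 0 i ^+ 2).

(* The set X as a type, with the subspace topology and the Borel
   sigma-algebra of that topology.  The proof of nonemptiness is a parameter
   because measurable types must be pointed. *)
Definition borel_subspace (T : topologicalType) (X : set T)
  (X0 : X !=set0) : Type := set_type X.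

Section borel_subspace.
Context (T : topologicalType) (X : set T) (X0 : X !=set0).
Local Notation S := (borel_subspace X0).

HB.instance Definition _ := Topological.copy S (set_type X).
HB.instance Definition _ :=
  isPointed.Build S (exist _ (projT1 (cid X0)) (mem_set (projT2 (cid X0)))).
HB.instance Definition _ := @isMeasurable.Build (sigma_display (@open S)) S
  <<s @open S >> (@sigma_algebra0 _ setT (@open S))
  (@sigma_algebraC _ (@open S)) (@sigma_algebra_bigcup _ setT (@open S)).

Definition borel_subspace_val (x : S) : T := set_val (x : set_type X).

End borel_subspace.

(* (1 - t) mu + t nu for t in [0, 1], and by convention mu for other t. *)
Definition mixture (disp : measure_display) (T : measurableType disp)
    (R : realType) (mu nu : probability T R) (t : R) (A : set T) : \bar R :=
  if 0 <= t <= 1 then ((1 - t)%:E * mu A + t%:E * nu A)%E else mu A.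

Section mixture_probability.
Context (disp : measure_display) (T : measurableType disp) (R : realType).
Variables (mu nu : probability T R) (t : R).
Local Notation mix := (mixture mu nu t).

Let mixtureE (t01 : 0 <= t <= 1) (s0 : 0 <= 1 - t) (t0 : 0 <= t) :
  mix = measure_add (mscale (NngNum s0) mu) (mscale (NngNum t0) nu).
Proof.
by apply/funext => A; rewrite measure_addE /mixture t01.
Qed.

Let mixture0 : mix set0 = 0%E.
Proof. by rewrite /mixture; case: ifP; rewrite !measure0// !mule0 adde0. Qed.

Let mixture_ge0 A : (0 <= mix A)%E.
Proof.
rewrite /mixture; case: ifP => // /andP[t0 t1].
by apply: adde_ge0; apply: mule_ge0 => //; rewrite lee_fin// subr_ge0.
Qed.

Let mixture_sigma_additive : semi_sigma_additive mix.
Proof.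
have [t01|t01] := boolP (0 <= t <= 1).
  have /andP[t0 t1] := t01.
  have s0 : 0 <= 1 - t by rewrite subr_ge0.
  by rewrite (mixtureE t01 s0 t0); exact: measure_semi_sigma_additive.
have -> : mix = mu by apply/funext => A; rewrite /mixture (negbTE t01).
exact: measure_semi_sigma_additive.
Qed.

HB.instance Definition _ := isMeasure.Build _ _ _ mix
  mixture0 mixture_ge0 mixture_sigma_additive.

Let mixture_setT : mix setT = 1%E.
Proof.
rewrite /mixture; case: ifP => _; rewrite !probability_setT// !mule1.
by rewrite -EFinD subrK.
Qed.

HB.instance Definition _ :=
  @Measure_isProbability.Build _ _ R mix mixture_setT.

End mixture_probability.

(* [J] is not required to identify elements of [probability T R] that agree on
   measurable sets only; functionals on honest Borel probability measures are
   those that do. *)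
Section influence_function.
Context (disp : measure_display) (T : measurableType disp) (R : realType).
Variable J : probability T R -> R.

Definition influence_quotient (mu : probability T R) (x : T) (t : R) : R :=
  t^-1 * (J (mixture mu (dirac x) t) - J mu).

Definition influence_exists (mu : probability T R) : Prop :=
  forall x : T, cvg (influence_quotient mu x t @[t --> 0^'+]).

(* Meaningful only when [influence_exists mu] holds. *)
Definition influence_function (mu : probability T R) (x : T) : R :=
  lim (influence_quotient mu x t @[t --> 0^'+]).

End influence_function.

(* [omega] is only used on [0, +oo[.  The bound [t <= 1] excludes the
   conventional values of [mixture]; it costs nothing since t0 can be
   shrunk. *)
Definition steep (R : realType) (d : nat) (X : set 'rV[R]_d) (X0 : X !=set0)
    (J : probability (borel_subspace X0) R -> R) : Prop :=
  forall (mu : probability (borel_subspace X0) R) (x : borel_subspace X0),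
  exists (t0 : R) (omega : R -> R),
    [/\ 0 < t0,
        forall s : R, 0 <= s -> 0 <= omega s,
        omega s / s @[s --> 0^'+] --> (0 : R) &
        forall (t : R) (y : borel_subspace X0), 0 < t < t0 -> t <= 1 ->
          `|J (mixture mu (dirac x) t) - J (mixture mu (dirac y) t)| <=
            t * omega (euclidean_norm
                         (borel_subspace_val x - borel_subspace_val y))].

(* Main.v *)
(* Dividing the steepness bound at (mu, x) by t and letting t tend to 0 gives
   |h_mu(x) - h_mu(y)| <= omega(|x - y|) for every y, and omega(s) = o(s) forces
   the right-hand side to 0 as y tends to x.  The value omega(0) is
   unconstrained, so y = x is treated apart. *)
Require Import Defs.
From mathcomp Require Import all_boot all_order all_algebra.
From mathcomp Require Import all_classical all_reals all_analysis.
Import numFieldTopology.Exports.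
Import Order.TTheory GRing.Theory Num.Theory.
Import numFieldNormedType.Exports.
Local Open Scope classical_set_scope.
Local Open Scope ring_scope.

Lemma euclidean_norm0 (R : realType) (d : nat) :
  euclidean_norm (0 : 'rV[R]_d) = 0.
Proof.
by rewrite /euclidean_norm big1 ?sqrtr0// => i _; rewrite mxE expr0n.
Qed.

Lemma euclidean_norm_eq0 (R : realType) (d : nat) (v : 'rV[R]_d) :
  euclidean_norm v = 0 -> v = 0.
Proof.
move=> /eqP; rewrite sqrtr_eq0 => sum_le0.
have /eqP : \sum_(i < d) v 0 i ^+ 2 = 0.
  by apply/eqP; rewrite eq_le sum_le0 sumr_ge0// => i _; rewrite sqr_ge0.
rewrite psumr_eq0 => [/allP v0|i _]; last exact: sqr_ge0.
apply/rowP => i; rewrite mxE; apply/eqP.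
by rewrite -sqrf_eq0; apply: (implyP (v0 i _)); rewrite ?mem_index_enum.
Qed.

(** The topology of ['rV[R]_d] comes from the sup norm, so continuity is derived from that of the
    coordinates, squares, finite sums and [Num.sqrt]. *)
Lemma continuous_euclidean_norm (R : realType) (d : nat) :
  continuous (@euclidean_norm R d).
Proof.
move=> v; apply: (@continuous_comp _ _ _
  (fun w : 'rV[R]_d => \sum_(i < d) w 0 i ^+ 2) Num.sqrt).
  apply: (@continuous_big R^o _ +%R 0 xpredT) => [|i _ w].
    exact: add_continuous.
  apply: (@continuous_comp _ _ _ (fun u : 'rV[R]_d => u 0 i)
    (fun r : R => r ^+ 2)).
    exact: coord_continuous.
  exact: exprn_continuous.
exact: sqrt_continuous.
Qed.

Lemma continuous_borel_subspace_val (T : topologicalType) (X : set T)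
    (X0 : X !=set0) :
  continuous (@borel_subspace_val T X X0).
Proof. exact: initial_continuous. Qed.

Lemma borel_subspace_val_inj (T : topologicalType) (X : set T)
    (X0 : X !=set0) :
  injective (@borel_subspace_val T X X0).
Proof. by move=> x y; apply: val_inj. Qed.

(** Close to 0 on the right, [omega s <= e * s] and [s <= 1]. The filter [0^'+] leaves out
    [s = 0]. *)
Lemma little_o_id_small (R : realType) (omega : R -> R) (e : R) :
  omega s / s @[s --> 0^'+] --> (0 : R) -> 0 < e ->
  \forall s \near 0^'+, omega s <= e.
Proof.
move=> omega_o e0; near=> s.
have s0 : 0 < s by [].
have omega_le : omega s / s <= e.
  by near: s; apply: (cvgr_le 0 omega_o).
rewrite ler_pdivrMr// in omega_le; rewrite (le_trans omega_le)//.
rewrite ler_piMr ?(ltW e0)//.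
by near: s; apply: nbhs_right_le.
Unshelve. all: by end_near. Qed.

(** The term [J mu] cancels in the difference of the two quotients, leaving [t^-1] times the
    difference bounded by [t * c]. As [c] does not depend on [t], the bound survives the limit. *)
Lemma influence_function_dist (disp : measure_display)
    (T : measurableType disp) (R : realType) (J : probability T R -> R)
    (mu : probability T R) (x y : T) (t0 c : R) :
  influence_exists J mu -> 0 < t0 ->
  (forall t, 0 < t < t0 -> t <= 1 ->
    `|J (mixture mu (dirac x) t) - J (mixture mu (dirac y) t)| <= t * c) ->
  `|influence_function J mu x - influence_function J mu y| <= c.
Proof.
move=> Jmu t0_gt0 Jc.
have dist_cvg : `|influence_quotient J mu x t - influence_quotient J mu y t|
    @[t --> 0^'+] --> `|influence_function J mu x - influence_function J mu y|.
  (* [Jmu] says that each quotient converges to its own [lim], which is the value of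
     [influence_function]. *)
  by apply: cvg_norm; apply: cvgB; [exact: Jmu|exact: Jmu].
apply: (cvgr_to_le dist_cvg).
near=> t.
have t_gt0 : 0 < t by [].
rewrite /influence_quotient -mulrBr opprB addrA subrK normrM.
rewrite gtr0_norm ?invr_gt0// mulrC ler_pdivrMr// mulrC Jc//.
  by rewrite t_gt0/=; near: t; apply: nbhs_right_lt.
by near: t; apply: nbhs_right_le.
Unshelve. all: by end_near. Qed.

Theorem lemma4 (R : realType) (d : nat) (X : set 'rV[R]_d) (X0 : X !=set0)
    (Xcompact : compact X)
    (J : probability (borel_subspace X0) R -> R)
    (Jinfluence : forall mu : probability (borel_subspace X0) R,
       influence_exists J mu)
    (Jsteep : steep J) :
  forall mu : probability (borel_subspace X0) R,
    continuous (influence_function J mu).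
Proof.
move=> mu x; have [t0 [omega [t0_gt0 _ omega_o Jomega]]] := Jsteep mu x.
apply/(@cvgrPdist_le _ _ _ (nbhs x)) => e e0.
have [r /= r0 omega_le] := little_o_id_small _ _ _ omega_o e0.
pose dist (y : borel_subspace X0) :=
  euclidean_norm (borel_subspace_val x - borel_subspace_val y).
have dist_cvg0 : dist y @[y --> x] --> (0 : R).
  (* Writing the limit 0 as the norm of [x - x] lets continuity of the norm at that point apply. *)
  rewrite -(euclidean_norm0 R d) -(subrr (borel_subspace_val x)).
  apply: (@cvg_comp _ _ _
    (fun y : borel_subspace X0 => borel_subspace_val x - borel_subspace_val y)
    (@euclidean_norm R d) (nbhs x) _ _ _ (continuous_euclidean_norm R d _)).
  apply: (@cvgB _ _ _ (nbhs x)); first exact: cvg_cst.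
  exact: continuous_borel_subspace_val.
have /(_ (nbhs_filter x)) := cvgr_lt 0 dist_cvg0 r r0.
apply: (@filterS _ (nbhs x) _) => y dist_lt.
(* [omega_le] covers only arguments strictly between 0 and [r]. Distance 0 forces [y = x], where the
   difference vanishes. *)
have [dist0|dist_neq0] := eqVneq (dist y) 0.
  have /subr0_eq/borel_subspace_val_inj <- := euclidean_norm_eq0 _ _ _ dist0.
  by rewrite subrr normr0 ltW.
have dist_gt0 : 0 < dist y by rewrite lt_neqAle eq_sym dist_neq0 sqrtr_ge0.
apply: le_trans (omega_le (dist y) _ dist_gt0); last first.
  by rewrite /= sub0r normrN gtr0_norm.
(* Here [c] is [omega (dist y)]; the same [t0] serves every [y]. *)
apply: (influence_function_dist _ _ _ _ _ _ _ t0) => // t t_lt t_le1.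
exact: Jomega.
Qed.
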